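(* Let $f:\mathbb{R}^n\to\mathbb{R}$ be convex and $L$-smooth with a minimizer $x^\star$, and let $\mathcal{P}\subseteq\mathbb{R}^{n\times n}$ be a closed convex set with $0\in\mathcal{P}$, $L^{-1}I\in\mathcal{P}$ and $\operatorname{diam}(\mathcal{P})\le D<\infty$. Let $K\ge 1$ and let $x^1,\dots,x^{K+1}$ be generated by the Hypergradient Descent Method (HDM, see context) with constant stepsize $\eta_k\equiv \frac{D}{(LD+1)\sqrt{K}}$. Put $$\rho_K := D(LD+1)\sqrt{K},\qquad \gamma_K^\star := -\min_{P\in\mathcal{P}}\frac1K\sum_{k=1}^K h_{x^k}(P),\qquad \Delta := \max_{x:\,f(x)\le f(x^1)}\ \min_{x^\star\in\mathcal{X}^\star}\|x-x^\star\|.$$ Then $$f(x^{K+1})-f(x^\star)\le \min\Big\{\frac{\Delta^2}{K\max\{\gamma_K^\star-\frac{\rho_K}{K},0\}},\ f(x^1)-f(x^\star)\Big\}.$$ If in addition $f$ is $\mu$-strongly convex with $\mu>0$, then $$f(x^{K+1})-f(x^\star)\le [f(x^1)-f(x^\star)]\Big(1-2\mu\max\{\gamma_K^\star-\tfrac{\rho_K}{K},0\}\Big)^K.$$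
   Context: $\|\cdot\|$ is the Euclidean norm, $\|\cdot\|_F$ the Frobenius norm, $\operatorname{diam}$ is taken in the Frobenius norm, $\Pi_{\mathcal{P}}$ is the orthogonal projection onto $\mathcal{P}$. $L$-smooth means $\nabla f$ is $L$-Lipschitz. $\mathcal{X}^\star=\{x: f(x)=\min f\}$ is the set of minimizers. A quotient with zero denominator is read as $+\infty$; the maximum defining $\Delta$ is read as a supremum, possibly $+\infty$. Hypergradient feedback: for $x\notin\mathcal{X}^\star$ and $P\in\mathbb{R}^{n\times n}$, $$h_x(P):=\frac{f(x-P\nabla f(x))-f(x)}{\|\nabla f(x)\|^2},\qquad \nabla h_x(P)=-\frac{\nabla f(x-P\nabla f(x))\nabla f(x)^\top}{\|\nabla f(x)\|^2}.$$ HDM: given $x^1\in\mathbb{R}^n$ and $P_1\in\mathcal{P}$, for $k=1,2,\dots$ set $$x^{k+1}\in\operatorname{argmin}_{x\in\{x^k,\ x^k-P_k\nabla f(x^k)\}} f(x),\qquad P_{k+1}=\Pi_{\mathcal{P}}[P_k-\eta_k\nabla h_{x^k}(P_k)].$$ The iterates $x^1,\dots,x^K$ are assumed not to be minimizers, so that the feedbacks are defined. *)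

(* Defs.v *)
From mathcomp Require Import all_boot all_order all_algebra.
From mathcomp Require Import all_classical all_reals all_analysis.
Set Implicit Arguments.
Unset Strict Implicit.
Unset Printing Implicit Defensive.
Import Order.TTheory GRing.Theory Num.Theory.
Import numFieldNormedType.Exports.
Local Open Scope classical_set_scope.
Local Open Scope ring_scope.

(* The library norm on matrices is the sup norm, which induces the same
   topology (closed sets, differentiability) as the two norms below. *)
Definition enorm (R : realType) (n : nat) (v : 'cV[R]_n) : R :=
  Num.sqrt (\sum_i v i 0 ^+ 2).

Definition fnorm (R : realType) (m n : nat) (A : 'M[R]_(m, n)) : R :=
  Num.sqrt (\sum_i \sum_j A i j ^+ 2).

Definition fdiam (R : realType) (n : nat) (Pset : set 'M[R]_n) : \bar R :=
  ereal_sup [set (fnorm (A - B))%:E | A in Pset & B in Pset].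

Definition argmin (R : realType) (T : Type) (f : T -> R) (A : set T) : set T :=
  [set x | A x /\ forall y, A y -> f x <= f y].

Definition minimizers (R : realType) (n : nat) (f : 'cV[R]_n -> R) :
  set 'cV[R]_n := argmin f setT.

Definition grad (R : realType) (n : nat) (f : 'cV[R]_n -> R) (x : 'cV[R]_n) :
  'cV[R]_n := \col_i 'D_(delta_mx i 0) f x.

Definition smooth (R : realType) (n : nat) (L : R) (f : 'cV[R]_n -> R) : Prop :=
  (forall x, differentiable f x) /\
  (forall x y, enorm (grad f x - grad f y) <= L * enorm (x - y)).

Definition strongly_convex (R : realType) (n : nat) (mu : R)
    (f : 'cV[R]_n -> R) : Prop :=
  forall (x y : 'cV[R]_n) (t : R), 0 <= t <= 1 ->
    f (t *: x + (1 - t) *: y)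
      <= t * f x + (1 - t) * f y - mu / 2 * t * (1 - t) * enorm (x - y) ^+ 2.

(* [B] is the orthogonal projection of [A] onto [Pset]; it exists and is unique
   when [Pset] is closed, convex and nonempty. *)
Definition is_proj (R : realType) (n : nat) (Pset : set 'M[R]_n)
    (A B : 'M[R]_n) : Prop :=
  argmin (fun C => fnorm (A - C)) Pset B.

Definition feedback (R : realType) (n : nat) (f : 'cV[R]_n -> R)
    (x : 'cV[R]_n) (P : 'M[R]_n) : R :=
  (f (x - P *m grad f x) - f x) / enorm (grad f x) ^+ 2.

Definition grad_feedback (R : realType) (n : nat) (f : 'cV[R]_n -> R)
    (x : 'cV[R]_n) (P : 'M[R]_n) : 'M[R]_n :=
  - ((enorm (grad f x) ^+ 2)^-1 *:
       (grad f (x - P *m grad f x) *m (grad f x)^T)).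

(* Iterates are indexed from 1; the values [x 0], [P 0] and those beyond
   index [K.+1] are irrelevant. *)
Definition HDM (R : realType) (n : nat) (f : 'cV[R]_n -> R)
    (Pset : set 'M[R]_n) (eta : nat -> R) (K : nat)
    (x : nat -> 'cV[R]_n) (P : nat -> 'M[R]_n) : Prop :=
  Pset (P 1%N) /\
  forall k : nat, (1 <= k <= K)%N ->
    argmin f [set x k; x k - P k *m grad f (x k)] (x k.+1) /\
    is_proj Pset (P k - eta k *: grad_feedback f (x k) (P k)) (P k.+1).

Definition rhoK (R : realType) (L D : R) (K : nat) : R :=
  D * (L * D + 1) * Num.sqrt K%:R.

(* The minimum over [Pset] is written [inf]: for [Pset] compact and nonempty and
   [f] continuous the infimum is attained. *)
Definition gammaK (R : realType) (n : nat) (f : 'cV[R]_n -> R)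
    (Pset : set 'M[R]_n) (K : nat) (x : nat -> 'cV[R]_n) : R :=
  - inf [set K%:R^-1 * \sum_(1 <= k < K.+1) feedback f (x k) Q | Q in Pset].

(* For a continuous [f] with a minimizer, [minimizers f] is closed and
   nonempty, so this infimum is a minimum as well. *)
Definition dist_minimizers (R : realType) (n : nat) (f : 'cV[R]_n -> R)
    (x : 'cV[R]_n) : R :=
  inf [set enorm (x - z) | z in minimizers f].

Definition Delta (R : realType) (n : nat) (f : 'cV[R]_n -> R)
    (x1 : 'cV[R]_n) : \bar R :=
  ereal_sup [set (dist_minimizers f x)%:E | x in [set x | f x <= f x1]].

(* Division where a zero denominator gives [+oo], whatever the numerator. *)
Definition ediv (R : realType) (a : \bar R) (b : R) : \bar R :=
  if b == 0 then +oo%E else (a * (b^-1)%:E)%E.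

(* Main.v *)
Require Import Defs.
From mathcomp Require Import all_boot all_order all_algebra.
From mathcomp Require Import all_classical all_reals all_analysis.
From mathcomp Require Import ring lra.

(** The method is online gradient descent on the preconditioner [P], and the
    convergence of [f (x k)] is read off from the regret of that online game.

    The feedback [h_x] is convex in [P], because [P |-> x - P g] is affine and
    [f] is convex, and its gradient has Frobenius norm at most [L D + 1] on a
    set of diameter [D] containing [0], because [grad f] is [L]-Lipschitz
    ([feedback_grad_le], [grad_feedback_bound]).  Projection onto a convex set
    does not increase the distance to its points, so the classical telescoping
    argument ([projected_gradient_regret]) bounds the regret against any fixed
    [Q]; the chosen stepsize balances its two terms and gives exactly [rhoK]
    ([HDM_regret]).  Taking the infimum over [Q], the average of
    [- h_(x k) (P k)] is at least [gammaK - rhoK / K].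

    On the other side, since the next iterate is the better of staying and
    moving, one step decreases [f] by at least [progress k * |grad f (x k)|^2]
    with [progress k = max (- h_(x k) (P k)) 0] ([HDM_descent]).  Only the sum
    of these numbers is controlled ([progress_sum_ge]), so the two rates must
    depend on the sum alone.
    - Convexity gives [f (x k) - min f <= Delta * |grad f (x k)|]; the inverse
      gap [1 / (f (x k) - min f)] then grows by at least
      [progress k / Delta^2] per step, and these increments add up
      ([sublinear_rate]).
    - Strong convexity gives the Polyak-Lojasiewicz inequality, so the gap is
      multiplied by at most [1 - 2 mu * progress k]; the product of these
      factors is bounded by the power of their mean, by the inequality of
      arithmetic and geometric means ([linear_rate]). *)

Set Implicit Arguments.
Unset Strict Implicit.
Unset Printing Implicit Defensive.
Import Order.TTheory GRing.Theory Num.Theory.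
Import numFieldNormedType.Exports.
Local Open Scope classical_set_scope.
Local Open Scope ring_scope.

(** * The Frobenius inner product *)

Section FrobeniusInnerProduct.
Context {R : realType}.

Definition finner (m n : nat) (A B : 'M[R]_(m, n)) : R :=
  \sum_i \sum_j A i j * B i j.

Lemma finnerC m n (A B : 'M[R]_(m, n)) : finner A B = finner B A.
Proof. by apply: eq_bigr => i _; apply: eq_bigr => j _; rewrite mulrC. Qed.

Lemma finnerDl m n (A B C : 'M[R]_(m, n)) :
  finner (A + B) C = finner A C + finner B C.
Proof.
rewrite /finner -big_split; apply: eq_bigr => i _ /=.
by rewrite -big_split; apply: eq_bigr => j _ /=; rewrite mxE mulrDl.
Qed.

Lemma finnerZl m n (a : R) (A B : 'M[R]_(m, n)) :
  finner (a *: A) B = a * finner A B.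
Proof.
rewrite /finner mulr_sumr; apply: eq_bigr => i _.
by rewrite mulr_sumr; apply: eq_bigr => j _; rewrite mxE mulrA.
Qed.

Lemma finnerNl m n (A B : 'M[R]_(m, n)) : finner (- A) B = - finner A B.
Proof. by rewrite -scaleN1r finnerZl mulN1r. Qed.

Lemma finnerDr m n (A B C : 'M[R]_(m, n)) :
  finner A (B + C) = finner A B + finner A C.
Proof. by rewrite ![finner A _]finnerC finnerDl. Qed.

Lemma finnerZr m n (a : R) (A B : 'M[R]_(m, n)) :
  finner A (a *: B) = a * finner A B.
Proof. by rewrite ![finner A _]finnerC finnerZl. Qed.

Lemma finnerNr m n (A B : 'M[R]_(m, n)) : finner A (- B) = - finner A B.
Proof. by rewrite ![finner A _]finnerC finnerNl. Qed.

Definition finnerE := (finnerDl, finnerDr, finnerNl, finnerNr, finnerZl,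
  finnerZr).

Lemma finner_ge0 m n (A : 'M[R]_(m, n)) : 0 <= finner A A.
Proof.
by apply: sumr_ge0 => i _; apply: sumr_ge0 => j _; rewrite -expr2 sqr_ge0.
Qed.

Lemma fnorm_ge0 m n (A : 'M[R]_(m, n)) : 0 <= fnorm A.
Proof. exact: sqrtr_ge0. Qed.

Lemma fnormE m n (A : 'M[R]_(m, n)) : fnorm A = Num.sqrt (finner A A).
Proof.
by congr Num.sqrt; apply: eq_bigr => i _; apply: eq_bigr => j _; rewrite expr2.
Qed.

Lemma sqr_fnorm m n (A : 'M[R]_(m, n)) : fnorm A ^+ 2 = finner A A.
Proof. by rewrite fnormE sqr_sqrtr ?finner_ge0. Qed.

Lemma enormE n (v : 'cV[R]_n) : enorm v = fnorm v.
Proof. by congr Num.sqrt; apply: eq_bigr => i _; rewrite big_ord1. Qed.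

Lemma fnormN m n (A : 'M[R]_(m, n)) : fnorm (- A) = fnorm A.
Proof. by rewrite !fnormE !finnerE opprK. Qed.

Lemma fnormZ m n (a : R) (A : 'M[R]_(m, n)) : fnorm (a *: A) = `|a| * fnorm A.
Proof. by rewrite !fnormE !finnerE mulrA -expr2 sqrtrM ?sqr_ge0// sqrtr_sqr. Qed.

Lemma fnorm0 m n : fnorm (0 : 'M[R]_(m, n)) = 0.
Proof. by rewrite -(scale0r 0) fnormZ normr0 mul0r. Qed.

Lemma fnorm_tr m n (A : 'M[R]_(m, n)) : fnorm A^T = fnorm A.
Proof.
congr Num.sqrt; rewrite exchange_big.
by apply: eq_bigr => i _; apply: eq_bigr => j _; rewrite mxE.
Qed.

Lemma fnorm_eq0 m n (A : 'M[R]_(m, n)) : fnorm A = 0 -> A = 0.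
Proof.
move=> A0; have : finner A A = 0 by rewrite -sqr_fnorm A0 expr0n.
move/eqP; rewrite psumr_eq0 => [/allP s0|i _]; last first.
  by apply: sumr_ge0 => j _; rewrite -expr2 sqr_ge0.
apply/matrixP => i j; rewrite mxE.
have := s0 i (mem_index_enum i); rewrite psumr_eq0 => [/allP t0|k _]; last first.
  by rewrite -expr2 sqr_ge0.
by have := t0 j (mem_index_enum j); rewrite /= mulf_eq0 orbb => /eqP.
Qed.

(** Cauchy-Schwarz: expand the square norm of [|B| A - |A| B]. *)
Lemma finner_le m n (A B : 'M[R]_(m, n)) : finner A B <= fnorm A * fnorm B.
Proof.
have [A0|A0] := eqVneq (fnorm A) 0.
  by rewrite A0 (fnorm_eq0 A0) -(scale0r 0) finnerZl !mul0r.
have [B0|B0] := eqVneq (fnorm B) 0.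
  by rewrite B0 (fnorm_eq0 B0) -(scale0r 0) finnerZr !mulr0 mul0r.
have a0 : 0 < fnorm A by rewrite lt_def A0 fnorm_ge0.
have b0 : 0 < fnorm B by rewrite lt_def B0 fnorm_ge0.
have := finner_ge0 (fnorm B *: A - fnorm A *: B).
rewrite !finnerE -!sqr_fnorm (finnerC B A) => h.
have {}h : 0 <= 2 * (fnorm A * fnorm B) * (fnorm A * fnorm B - finner A B) by lra.
by rewrite pmulr_rge0 ?subr_ge0// in h; rewrite mulr_gt0 ?mulr_gt0.
Qed.

Lemma sqr_finner_le m n (A B : 'M[R]_(m, n)) :
  finner A B ^+ 2 <= finner A A * finner B B.
Proof.
rewrite -!sqr_fnorm -exprMn -ler_sqrt ?sqr_ge0// !sqrtr_sqr.
rewrite [leRHS]ger0_norm ?mulr_ge0 ?fnorm_ge0// ler_norml finner_le andbT.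
by rewrite -lerN2 opprK -finnerNl -(fnormN A) finner_le.
Qed.

Lemma fnorm_leD m n (A B : 'M[R]_(m, n)) : fnorm (A + B) <= fnorm A + fnorm B.
Proof.
rewrite -(@ler_pXn2r _ 2) ?nnegrE ?addr_ge0 ?fnorm_ge0// sqr_fnorm !finnerE.
rewrite (finnerC B A) -!sqr_fnorm.
by have := finner_le A B; lra.
Qed.

Lemma finner_row m p n (A : 'M[R]_(m, n)) (B : 'M[R]_(p, n)) i j :
  finner (row i A) (row j B) = \sum_k A i k * B j k.
Proof. by rewrite /finner big_ord1; apply: eq_bigr => k _; rewrite !mxE. Qed.

(** Each entry of [A *m B] is the inner product of a row of [A] with a column of
    [B], so Cauchy-Schwarz applies entrywise.  For a column [B] this says that
    the Frobenius norm dominates the operator norm. *)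
Lemma fnorm_mulmx m n p (A : 'M[R]_(m, n)) (B : 'M[R]_(n, p)) :
  fnorm (A *m B) <= fnorm A * fnorm B.
Proof.
rewrite -(@ler_pXn2r _ 2) ?nnegrE ?mulr_ge0 ?fnorm_ge0// exprMn.
rewrite -(fnorm_tr B) !sqr_fnorm /finner mulr_suml; apply: ler_sum => i _.
rewrite mulr_sumr; apply: ler_sum => j _.
rewrite -!finner_row -expr2 (_ : (A *m B) i j = finner (row i A) (row j B^T)).
  exact: sqr_finner_le.
by rewrite finner_row mxE; apply: eq_bigr => k _; rewrite mxE.
Qed.

(** Turns the pairing of a rank-one feedback gradient with a direction [M] into
    a pairing of vectors. *)
Lemma finner_mulmx_tr m n (u : 'cV[R]_m) (v : 'cV[R]_n) (M : 'M[R]_(m, n)) :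
  finner (u *m v^T) M = finner u (M *m v).
Proof.
apply: eq_bigr => i _; rewrite big_ord1 mxE mulr_sumr; apply: eq_bigr => j _.
by rewrite !mxE big_ord1 mxE mulrA mulrAC.
Qed.

End FrobeniusInnerProduct.

(** * First-order consequences of convexity *)

(** Lets a real number in the unit interval be used where the library's convex
    combinations expect an element of the interval type. *)
Lemma i01_of_real (R : realType) (t : R) : 0 <= t <= 1 ->
  exists s : {i01 R}, s%:num = t.
Proof.
move=> t01.
have t01' : Itv.spec (@Itv.num_sem R) (Itv.Real `[0%Z, 1%Z]) t.
  by rewrite /= /Itv.num_sem/= num_real in_itv/=.
by exists (Itv.mk t01').
Qed.

Section FirstOrder.
Context {R : realType} {n : nat}.
Implicit Types (f : 'cV[R]_n -> R) (x y v : 'cV[R]_n).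

Lemma derive_grad f x v : differentiable f x -> 'D_v f x = finner (grad f x) v.
Proof.
move=> df; rewrite deriveE// {1}(matrix_sum_delta v) linear_sum.
apply: eq_bigr => i _; rewrite linear_sum !big_ord1.
by rewrite linearZ /= mxE deriveE// mulrC.
Qed.

(** Makes the first-order inequality for convex functions the case [mu = 0] of
    the one for strongly convex functions. *)
Lemma convex_strongly_convex0 f :
  convex_function setT f -> strongly_convex 0 f.
Proof.
move=> cf x y t t01; rewrite !mul0r subr0.
have [s <-] := i01_of_real t01; exact: cf (in_setT _) (in_setT _).
Qed.

(** Along the segment from [x] to [y], strong convexity bounds the difference
    quotient at [h] by [f y - f x - mu / 2 * (1 - h) * |y - x|^2]; let [h] tend
    to [0] from the right. *)
Lemma strongly_convex_grad mu f x y : differentiable f x ->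
  strongly_convex mu f ->
  f x + finner (grad f x) (y - x) + mu / 2 * enorm (y - x) ^+ 2 <= f y.
Proof.
move=> df cf; rewrite -derive_grad//.
set v := y - x; set c := mu / 2 * enorm v ^+ 2.
suff : 'D_v f x <= f y - f x - c by lra.
pose q (h : R) := h^-1 *: ((f \o shift x) (h *: v) - f x).
have qD : q h @[h --> 0^'+] --> 'D_v f x.
  exact/cvg_dnbhs_at_right/(@diff_derivable _ _ _ f x v df).
have rD : (f y - f x - c + h * c) @[h --> 0^'+] --> f y - f x - c + 0 * c.
  apply: cvg_at_right_filter; apply: cvgD; first exact: cvg_cst.
  by apply: cvgMl; exact: cvg_id.
rewrite -[leRHS]addr0 -(mul0r c).
apply: (ler_cvg_to qD rD); near=> h.
have h0 : 0 < h by near: h; exact: nbhs_right_gt.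
have h1 : h <= 1 by near: h; apply: nbhs_right_le; exact: ltr01.
rewrite /q /= /GRing.scale /= ler_pdivrMl//.
have := cf y x h; rewrite (ltW h0) h1 => /(_ isT).
rewrite (_ : h *: y + _ = h *: v + x); last first.
  by rewrite /v scalerBr scalerBl scale1r -addrA (addrC (- _)).
by rewrite -/v /c; lra.
Unshelve. all: by end_near. Qed.

Lemma convex_grad f x y : differentiable f x -> convex_function setT f ->
  f x + finner (grad f x) (y - x) <= f y.
Proof.
move=> df /convex_strongly_convex0 /(strongly_convex_grad y df).
by rewrite !mul0r addr0.
Qed.

(** The Polyak-Lojasiewicz inequality: minimize over [y - x] the lower bound of
    [strongly_convex_grad], that is, complete the square
    [|grad f x + mu (y - x)|^2 >= 0]. *)
Lemma strongly_convex_PL mu f x y : 0 < mu -> differentiable f x ->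
  strongly_convex mu f -> 2 * mu * (f x - f y) <= enorm (grad f x) ^+ 2.
Proof.
move=> mu0 df /(strongly_convex_grad y df) sc.
have := finner_ge0 (grad f x + mu *: (y - x)).
rewrite !enormE !sqr_fnorm in sc *.
rewrite (finnerDl (grad f x)) (finnerDr (grad f x)) (finnerDr (mu *: _)) !finnerZl !finnerZr.
rewrite (finnerC (y - x) (grad f x)) => h.
have := ler_wpM2l (ltW mu0) sc; lra.
Qed.

End FirstOrder.

(** * Projected online gradient descent *)

Section ProjectedGradient.
Context {R : realType} {n : nat}.
Implicit Types (S : set 'M[R]_n) (A B C : 'M[R]_n).

Lemma convex_set_comb S A B (t : R) : convex_set S -> S A -> S B ->
  0 <= t <= 1 -> S (t *: A + (1 - t) *: B).
Proof.
move=> cS SA SB t01.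
have [s <-] := i01_of_real t01.
by have /set_mem := cS A B s (mem_set SA) (mem_set SB).
Qed.

(** Moving from the projection [B] a little towards [C] stays in [S] and would
    bring one closer to [A] if the angle at [B] were acute. *)
Lemma is_proj_obtuse S A B C : convex_set S -> is_proj S A B -> S C ->
  finner (A - B) (C - B) <= 0.
Proof.
move=> cS [SB minB] SC; rewrite leNgt; apply/negP => s0.
set s := finner _ _ in s0; set q := finner (C - B) (C - B).
have q0 : 0 <= q := finner_ge0 _.
have sq0 : 0 < s + q by lra.
(* With this step, [t <= 1] and the quadratic term [t * q <= s] is too small to
   compensate the linear gain [2 * s]. *)
pose t := s / (s + q).
have t0 : 0 < t by rewrite divr_gt0.
have t1 : t <= 1 by rewrite ler_pdivrMr//; lra.
have tsq : t * s + t * q = s by rewrite -mulrDr divfK// gt_eqF.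
have := minB _ (convex_set_comb cS SC SB (_ : 0 <= t <= 1)).
rewrite (ltW t0) t1 => /(_ isT).
rewrite (_ : A - (t *: C + (1 - t) *: B) = (A - B) - t *: (C - B)); last first.
  by rewrite scalerBr scalerBl scale1r !opprD !opprK addrACA -!addrA; congr (_ + _);
    rewrite addrCA.
rewrite -(@ler_pXn2r _ 2) ?nnegrE ?fnorm_ge0// !sqr_fnorm.
rewrite (finnerDl (A - B)) !(finnerDr _ (A - B)) !finnerNl !finnerNr.
rewrite !finnerZl !finnerZr (finnerC (C - B) (A - B)) -/s -/q => h.
have {}h : 0 <= t * (t * q - 2 * s) by lra.
rewrite pmulr_rge0// in h.
by have := mulr_gt0 t0 s0; lra.
Qed.

Lemma is_proj_le S A B C : convex_set S -> is_proj S A B -> S C ->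
  fnorm (B - C) ^+ 2 <= fnorm (A - C) ^+ 2.
Proof.
move=> cS pB SC; have := is_proj_obtuse cS pB SC.
rewrite -(opprB B C) finnerNr => h.
have -> : A - C = (A - B) + (B - C) by rewrite addrA subrK.
have := finner_ge0 (A - B).
rewrite !sqr_fnorm (finnerDl (A - B)) !(finnerDr _ (A - B)).
by rewrite (finnerC (B - C) (A - B)); lra.
Qed.

(** One projected step changes [|P k - Q|^2] by at most
    [- 2 eta <G k, P k - Q> + eta^2 |G k|^2]; these inequalities telescope.  The
    directions [G k] are arbitrary, so that they may depend on the past. *)
Lemma projected_gradient_regret S (P G : nat -> 'M[R]_n) Q (eta M : R) K :
  convex_set S -> 0 < eta -> S Q ->
  (forall k, (1 <= k <= K)%N -> fnorm (G k) <= M) ->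
  (forall k, (1 <= k <= K)%N -> is_proj S (P k - eta *: G k) (P k.+1)) ->
  \sum_(1 <= k < K.+1) finner (G k) (P k - Q)
    <= fnorm (P 1%N - Q) ^+ 2 / (2 * eta) + eta / 2 * K%:R * M ^+ 2.
Proof.
move=> cS eta0 SQ GM PS.
suff : forall m, (m <= K)%N ->
    2 * eta * \sum_(1 <= k < m.+1) finner (G k) (P k - Q)
      <= fnorm (P 1%N - Q) ^+ 2 - fnorm (P m.+1 - Q) ^+ 2
         + m%:R * (eta ^+ 2 * M ^+ 2).
  move=> /(_ K (leqnn K)) h.
  have e2 : 0 < 2 * eta by rewrite mulr_gt0.
  rewrite -(ler_pM2l e2); apply: (le_trans h).
  rewrite mulrDr (mulrC (2 * eta) (_ / _)) divfK ?gt_eqF//.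
  by have := sqr_ge0 (fnorm (P K.+1 - Q)); lra.
elim=> [_|m IH mK]; first by rewrite big_geq// mulr0 subrr mul0r addr0.
have mK' : (1 <= m.+1 <= K)%N by [].
rewrite big_nat_recr//= mulrDr.
have := is_proj_le cS (PS _ mK') SQ.
rewrite -addrA (addrC (- _)) addrA [X in _ <= X]sqr_fnorm.
rewrite (finnerDl (P m.+1 - Q)) !(finnerDr _ (P m.+1 - Q)) !finnerNl !finnerNr.
rewrite !finnerZl !finnerZr (finnerC (P m.+1 - Q)) -!sqr_fnorm.
have GG : fnorm (G m.+1) ^+ 2 <= M ^+ 2.
  by rewrite ler_pXn2r ?nnegrE ?(le_trans (fnorm_ge0 _) (GM _ mK')) ?fnorm_ge0// GM.
have := ler_wpM2l (sqr_ge0 eta) GG.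
have := IH (ltnW mK); rewrite -[in X in _ -> _ -> _ -> X](natr1 m).
by lra.
Qed.

End ProjectedGradient.

(** * Rates from the sum of the decreases *)

Section Rates.
Context {R : realType}.
Implicit Types (e c : nat -> R).

(** Since [e] is nonincreasing, [1 / e (k+1) - 1 / e k] is at least
    [(e k - e (k+1)) / (e k)^2 >= c k], and the inverses telescope. *)
Lemma sublinear_rate e c K :
  (forall k, (1 <= k <= K.+1)%N -> 0 < e k) ->
  (forall k, (1 <= k <= K)%N -> 0 <= c k) ->
  (forall k, (1 <= k <= K)%N -> e k.+1 <= e k - c k * e k ^+ 2) ->
  \sum_(1 <= k < K.+1) c k <= (e K.+1)^-1.
Proof.
move=> e0 c0 de; suff : forall m, (m <= K)%N ->
    \sum_(1 <= k < m.+1) c k <= (e m.+1)^-1 by apply.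
elim=> [K0|m IH mK]; first by rewrite big_geq// invr_ge0 ltW ?e0.
rewrite big_nat_recr//=; have {}IH := IH (ltnW mK).
have m1 : (1 <= m.+1 <= K)%N by [].
have a0 : 0 < e m.+1 by rewrite e0//= leqW.
have b0 : 0 < e m.+2 by rewrite e0//=.
have := de _ m1; have := c0 _ m1.
move: (e m.+1) (e m.+2) (c m.+1) a0 b0 IH => a b d a0 b0 IH d0 h.
have ba : b <= a by have := mulr_ge0 d0 (sqr_ge0 a); lra.
have dab : d * (a * b) <= a - b.
  by rewrite (@le_trans _ _ (d * a ^+ 2))//; [rewrite ler_wpM2l// expr2 ler_pM2l|lra].
have : d <= b^-1 - a^-1.
  rewrite (_ : _ - _ = (a - b) / (a * b)).
    by rewrite ler_pdivlMr ?mulr_gt0.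
  by field; rewrite !gt_eqF.
by lra.
Qed.

(** The factors [1 - c k] are nonnegative because the gaps are, so the inequality
    of arithmetic and geometric means bounds their product by the power of
    their mean, which is at most [1 - delta]. *)
Lemma linear_rate e c K (delta : R) : (1 <= K)%N ->
  (forall k, (1 <= k <= K)%N -> 0 < e k) -> 0 <= e K.+1 ->
  (forall k, (1 <= k <= K)%N -> e k.+1 <= e k * (1 - c k)) ->
  K%:R * delta <= \sum_(1 <= k < K.+1) c k ->
  e K.+1 <= e 1%N * (1 - delta) ^+ K.
Proof.
move=> K1 e0 eK de cK.
have K0 : (0 : R) < K%:R by rewrite ltr0n.
have c1 k : (1 <= k <= K)%N -> 0 <= 1 - c k.
  move=> kK; rewrite -(pmulr_rge0 _ (e0 _ kK)); apply: le_trans (de _ kK).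
  have [->//|kneK] := eqVneq k K.
  by rewrite ltW// e0//= ltn_neqAle kneK; case/andP: kK.
have prodE m : (m <= K)%N ->
    e m.+1 <= e 1%N * \prod_(1 <= k < m.+1) (1 - c k).
  elim: m => [_|m IH mK]; first by rewrite big_geq// mulr1.
  rewrite big_nat_recr//= mulrA; apply: (le_trans (de m.+1 _)) => //.
  by rewrite ler_wpM2r ?c1 ?IH// ltnW.
apply: (le_trans (prodE K (leqnn K))).
rewrite ler_wpM2l ?(ltW (e0 _ _))// big_add1 /= big_mkord.
have pos : {in 'I_K, forall i : 'I_K, 0 <= 1 - c i.+1}.
  by move=> i _; rewrite c1//=.
have /leifP := leif_AGM pos; rewrite card_ord => agm.
have {agm} : \prod_(i < K) (1 - c i.+1) <= ((\sum_(i < K) (1 - c i.+1)) / K%:R) ^+ K.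
  by move: agm; case: ifP => _; [move=> /eqP ->|move/ltW].
move=> /le_trans; apply.
have mean_ge0 : 0 <= (\sum_(i < K) (1 - c i.+1)) / K%:R.
  by rewrite divr_ge0 ?sumr_ge0 ?(ltW K0)// => i _; rewrite pos.
have mean_le : (\sum_(i < K) (1 - c i.+1)) / K%:R <= 1 - delta.
  rewrite ler_pdivrMr// sumrB sumr_const card_ord.
  by move: cK; rewrite big_add1 /= big_mkord; lra.
by rewrite lerXn2r ?nnegrE// (le_trans mean_ge0).
Qed.

End Rates.

(** * The hypergradient feedback *)

Section HypergradientFeedback.
Context {R : realType} {n : nat}.
Variables (f : 'cV[R]_n -> R) (L : R).
Hypotheses (hL : 0 < L) (hconv : convex_function setT f)
  (hsmooth : smooth L f).

(** A critical point of a convex function is a minimizer; this is what makes the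
    feedbacks at the iterates meaningful. *)
Lemma convex_grad_gt0 x : ~ minimizers f x -> 0 < enorm (grad f x).
Proof.
move=> xmin; rewrite enormE lt_def fnorm_ge0 andbT; apply/eqP => /fnorm_eq0 g0.
apply: xmin; split=> // y _.
have := convex_grad y (hsmooth.1 x) hconv.
by rewrite g0 -(scale0r 0) finnerZl mul0r addr0.
Qed.

(** The feedback is convex in the preconditioner: this is the first-order
    inequality of [f] at [x - P g] towards [x - Q g], divided by [|g|^2]. *)
Lemma feedback_grad_le x (P Q : 'M[R]_n) :
  feedback f x P - feedback f x Q <= finner (grad_feedback f x P) (P - Q).
Proof.
rewrite /feedback /grad_feedback -mulrBl opprB addrA subrK.
rewrite finnerNl finnerZl finner_mulmx_tr (mulrC _^-1) -mulNr.
rewrite ler_wpM2r ?invr_ge0 ?sqr_ge0//.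
have := convex_grad (x - Q *m grad f x) (hsmooth.1 (x - P *m grad f x)) hconv.
rewrite (_ : x - Q *m _ - _ = (P - Q) *m grad f x); first lra.
by rewrite opprB addrC addrA subrK mulmxBl.
Qed.

(** The gradient at the trial point differs from [g = grad f x] by at most
    [L * |P g| <= L * D * |g|]. *)
Lemma grad_feedback_bound x (P : 'M[R]_n) (D : R) :
  0 < enorm (grad f x) -> fnorm P <= D ->
  fnorm (grad_feedback f x P) <= L * D + 1.
Proof.
move=> g0 PD; rewrite /grad_feedback fnormN fnormZ.
rewrite ger0_norm ?invr_ge0 ?sqr_ge0// mulrC ler_pdivrMr ?exprn_gt0//.
apply: (le_trans (fnorm_mulmx _ _)); rewrite fnorm_tr -enormE expr2 mulrA.
rewrite -enormE ler_pM2r//.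
set y := x - P *m grad f x.
have Pg : enorm (y - x) <= D * enorm (grad f x).
  rewrite !enormE /y addrC addKr fnormN (le_trans (fnorm_mulmx _ _))//.
  by rewrite ler_wpM2r ?fnorm_ge0.
have := hsmooth.2 y x => /le_trans /(_ (ler_wpM2l (ltW hL) Pg)).
have := fnorm_leD (grad f y - grad f x) (grad f x).
by rewrite subrK -!enormE; lra.
Qed.

End HypergradientFeedback.

(** * Distance to the minimizers *)

Section Minimizers.
Context {R : realType} {n : nat}.
Variables (f : 'cV[R]_n -> R) (z : 'cV[R]_n).
Hypothesis (hz : minimizers f z).

Lemma dist_minimizers_ge0 x : 0 <= dist_minimizers f x.
Proof.
apply: lb_le_inf; first by exists (enorm (x - z)), z.
by move=> _ [w _ <-]; rewrite enormE fnorm_ge0.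
Qed.

(** The first-order inequality towards any minimizer [w] and Cauchy-Schwarz give
    [f x - f z <= |grad f x| * |x - w|]; the left side is the same for all [w],
    so one may pass to the infimum. *)
Lemma convex_gap_le x : differentiable f x -> convex_function setT f ->
  0 < enorm (grad f x) -> f x - f z <= enorm (grad f x) * dist_minimizers f x.
Proof.
move=> df cf g0; rewrite -ler_pdivrMl// mulrC.
apply: lb_le_inf; first by exists (enorm (x - z)), z.
move=> _ [w [_ wmin] <-]; rewrite ler_pdivrMr// mulrC.
have := convex_grad w df cf; rewrite -opprB finnerNr => h.
have := finner_le (grad f x) (x - w); rewrite -!enormE.
by have := wmin z I; lra.
Qed.

Lemma Delta_ge0 x : (0 <= Delta f x)%E.
Proof.
apply: (@le_trans _ _ (dist_minimizers f x)%:E).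
  by rewrite lee_fin dist_minimizers_ge0.
by apply: ereal_sup_ubound; exists x => //=.
Qed.

End Minimizers.

(** * The hypergradient descent method *)

Section HypergradientDescent.
Context {R : realType} {n : nat}.
Variables (f : 'cV[R]_n -> R) (Pset : set 'M[R]_n) (K : nat).
Variables (eta : nat -> R) (x : nat -> 'cV[R]_n) (P : nat -> 'M[R]_n).
Hypothesis hHDM : HDM f Pset eta K x P.

Lemma HDM_mem k : (1 <= k <= K.+1)%N -> Pset (P k).
Proof.
case: k => [//|[_|k /= kK]]; first exact: hHDM.1.
by have [_ []] := hHDM.2 k.+1 kK.
Qed.

(** The positive part accounts for the iterations in which the trial point is
    rejected. *)
Definition progress k : R := Num.max (- feedback f (x k) (P k)) 0.

Lemma progress_ge0 k : 0 <= progress k.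
Proof. by rewrite /progress le_max lexx orbT. Qed.

Lemma HDM_descent k : (1 <= k <= K)%N -> 0 < enorm (grad f (x k)) ->
  f (x k.+1) <= f (x k) - progress k * enorm (grad f (x k)) ^+ 2.
Proof.
move=> kK g0; have [[_ xmin] _] := hHDM.2 k kK.
rewrite /progress; case: (leP (- feedback _ _ _)) => _.
  by rewrite mul0r subr0; apply: xmin; left.
rewrite mulNr opprK /feedback divfK ?gt_eqF ?exprn_gt0//.
by rewrite addrC subrK; apply: xmin; right.
Qed.

Lemma HDM_nonincreasing k : (1 <= k <= K.+1)%N -> f (x k) <= f (x 1%N).
Proof.
elim: k => [//|[//|k] IH /= kK].
have [[_ xmin] _] := hHDM.2 k.+1 kK.
apply: le_trans (xmin _ (or_introl erefl)) _.
by apply: IH; exact: ltnW.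
Qed.

End HypergradientDescent.

Section HypergradientRegret.
Context {R : realType} {n : nat}.
Variables (f : 'cV[R]_n -> R) (L : R) (Pset : set 'M[R]_n) (D : R) (K : nat).
Variables (x : nat -> 'cV[R]_n) (P : nat -> 'M[R]_n).
Hypotheses (hL : 0 < L) (hconv : convex_function setT f)
  (hsmooth : smooth L f) (hSconvex : convex_set Pset) (hS0 : Pset 0)
  (hSL : Pset (L^-1 *: 1%:M)) (hdiam : (fdiam Pset <= D%:E)%E)
  (hK : (1 <= K)%N)
  (hHDM : HDM f Pset (fun _ => D / ((L * D + 1) * Num.sqrt K%:R)) K x P)
  (hx : forall k : nat, (1 <= k <= K)%N -> ~ minimizers f (x k)).

Lemma fdiam_le A B : Pset A -> Pset B -> fnorm (A - B) <= D.
Proof.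
move=> SA SB; rewrite -lee_fin; apply: le_trans hdiam.
by apply: ereal_sup_ubound; exists A => //; exists B.
Qed.

(** The existence of a non-minimizer excludes dimension [0], so [0] and
    [L^-1 I] are distinct points of the set.  The stepsize is then positive. *)
Lemma diam_gt0 : 0 < D.
Proof.
have K1 : (1 <= 1 <= K)%N by [].
have g0 := convex_grad_gt0 hconv hsmooth (hx K1).
have := fdiam_le hSL hS0; rewrite subr0; apply: lt_le_trans.
rewrite lt_def fnorm_ge0 andbT; apply: contraTneq g0 => /fnorm_eq0 I0.
rewrite -leNgt -[X in enorm X]mul1mx -[1%:M](@scalerKV _ _ L) ?gt_eqF//.
by rewrite I0 scaler0 mul0mx enormE fnorm0.
Qed.

(** The regret bound is [D^2 / (2 eta) + eta K M^2 / 2] with [M = L D + 1]; at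
    [eta = D / (M sqrt K)] both terms equal [D M sqrt K / 2]. *)
Lemma HDM_regret Q : Pset Q ->
  \sum_(1 <= k < K.+1) feedback f (x k) (P k)
    <= \sum_(1 <= k < K.+1) feedback f (x k) Q + rhoK L D K.
Proof.
move=> SQ; have D0 := diam_gt0.
set M := L * D + 1; set s := Num.sqrt (K%:R : R).
have M0 : 0 < M by rewrite addr_gt0// mulr_gt0.
have s0 : 0 < s by rewrite sqrtr_gt0 ltr0n.
have sK : s ^+ 2 = K%:R by rewrite sqr_sqrtr// ler0n.
have eta0 : 0 < D / (M * s) by rewrite divr_gt0// mulr_gt0.
have := @projected_gradient_regret _ _ Pset P
  (fun k => grad_feedback f (x k) (P k)) Q _ M K hSconvex eta0 SQ.
have GM k : (1 <= k <= K)%N -> fnorm (grad_feedback f (x k) (P k)) <= M.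
  move=> kK; apply: grad_feedback_bound => //.
    exact: (convex_grad_gt0 hconv hsmooth (hx kK)).
  rewrite -(subr0 (P k)); apply: fdiam_le => //.
  by apply: (HDM_mem hHDM); case/andP: kK => -> /=; exact: leqW.
move=> /(_ GM (fun k kK => (hHDM.2 k kK).2)) h.
rewrite -lerBlDl -sumrB; apply: le_trans.
  by apply: ler_sum => k _; exact: (feedback_grad_le hconv hsmooth).
apply: (le_trans h).
have P1Q : fnorm (P 1%N - Q) ^+ 2 <= D ^+ 2.
  rewrite ler_pXn2r ?nnegrE ?fnorm_ge0 ?(ltW D0)//.
  exact: (fdiam_le hHDM.1 SQ).
apply: (@le_trans _ _ (D ^+ 2 / (2 * (D / (M * s)))
    + D / (M * s) / 2 * K%:R * M ^+ 2)).
  by rewrite lerD2r ler_wpM2r// invr_ge0 mulr_ge0// ltW.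
rewrite /rhoK -/M -/s -sK le_eqVlt; apply/orP; left; apply/eqP.
by field; rewrite !gt_eqF.
Qed.

(** The regret bound holds against every [Q], hence against the infimum defining
    [gammaK], whether or not it is attained. *)
Lemma gammaK_le :
  gammaK f Pset K x - rhoK L D K / K%:R
    <= K%:R^-1 * \sum_(1 <= k < K.+1) - feedback f (x k) (P k).
Proof.
have K0 : (0 : R) < K%:R by rewrite ltr0n.
rewrite sumrN mulrN /gammaK -opprD lerN2 -lerBlDr.
apply: lb_le_inf; first by exists (K%:R^-1 * \sum_(1 <= k < K.+1) feedback f (x k) 0), 0.
move=> _ [Q SQ <-]; rewrite (mulrC (rhoK _ _ _)) -mulrBr ler_pM2l ?invr_gt0//.
by rewrite lerBlDr HDM_regret.
Qed.

Lemma progress_sum_ge :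
  K%:R * Num.max (gammaK f Pset K x - rhoK L D K / K%:R) 0
    <= \sum_(1 <= k < K.+1) progress f x P k.
Proof.
have K0 : (0 : R) < K%:R by rewrite ltr0n.
case: (leP (_ - _) 0) => _; first by rewrite mulr0 sumr_ge0// => k _; exact: progress_ge0.
rewrite -ler_pdivlMl//; apply: (le_trans gammaK_le).
rewrite ler_pM2l ?invr_gt0//; apply: ler_sum => k _.
by rewrite /progress le_max lexx.
Qed.

End HypergradientRegret.

(** * Convergence rates *)

Theorem theorem3p1 (R : realType) (n : nat) (f : 'cV[R]_n -> R) (L : R)
    (xstar : 'cV[R]_n) (Pset : set 'M[R]_n) (D : R) (K : nat)
    (x : nat -> 'cV[R]_n) (P : nat -> 'M[R]_n)
    (hL : 0 < L)
    (hconv : convex_function setT f)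
    (hsmooth : smooth L f)
    (hxstar : minimizers f xstar)
    (hSclosed : closed Pset)
    (hSconvex : convex_set Pset)
    (hS0 : Pset 0)
    (hSL : Pset (L^-1 *: 1%:M))
    (hdiam : (fdiam Pset <= D%:E)%E)
    (hK : (1 <= K)%N)
    (hHDM : HDM f Pset (fun _ => D / ((L * D + 1) * Num.sqrt K%:R)) K x P)
    (hx : forall k : nat, (1 <= k <= K)%N -> ~ minimizers f (x k)) :
  ((f (x K.+1) - f xstar)%:E <=
     mine (ediv (Delta f (x 1%N) ^+ 2)
             (K%:R * Num.max (gammaK f Pset K x - rhoK L D K / K%:R) 0)%R)
          (f (x 1%N) - f xstar)%:E)%E
  /\
  (forall mu : R, 0 < mu -> strongly_convex mu f ->
     f (x K.+1) - f xstar <=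
       (f (x 1%N) - f xstar) *
       (1 - 2 * mu * Num.max (gammaK f Pset K x - rhoK L D K / K%:R) 0) ^+ K).
Proof.
set delta := Num.max _ 0.
have K0 : (0 : R) < K%:R by rewrite ltr0n.
have delta0 : 0 <= delta by rewrite /delta le_max lexx orbT.
have psum : K%:R * delta <= \sum_(1 <= k < K.+1) progress f x P k.
  exact: (progress_sum_ge hL hconv hsmooth hSconvex hS0 hSL hdiam hK hHDM hx).
have g0 k (kK : (1 <= k <= K)%N) : 0 < enorm (grad f (x k)).
  exact: (convex_grad_gt0 hconv hsmooth (hx _ kK)).
have gap_ge0 k : 0 <= f (x k) - f xstar by rewrite subr_ge0 hxstar.2.
have gap_gt0 k : (1 <= k <= K)%N -> 0 < f (x k) - f xstar.
  move=> kK; rewrite lt_def gap_ge0 andbT; apply: contra_notN (hx _ kK).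
  by rewrite subr_eq0 => /eqP fE; split=> // y _; rewrite fE hxstar.2.
split; last first.
  move=> mu mu0 sc.
  apply: (@linear_rate _ (fun k => f (x k) - f xstar)
    (fun k => 2 * mu * progress f x P k)) => //.
  - move=> k kK; have := HDM_descent hHDM kK (g0 k kK).
    have := ler_wpM2l (progress_ge0 f x P k)
      (strongly_convex_PL xstar mu0 (hsmooth.1 (x k)) sc).
    lra.
  - rewrite -mulr_sumr mulrCA ler_wpM2l ?mulr_ge0 ?(ltW mu0)//.
rewrite le_min lee_fin lerB ?(HDM_nonincreasing hHDM) ?ltnSn// andbT.
rewrite /ediv; case: eqVneq => [_|b0]; first by rewrite leey.
have {b0} b0 : 0 < K%:R * delta by rewrite lt_def b0 mulr_ge0// ltW.
have := Delta_ge0 hxstar (x 1%N).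
(* An infinite [Delta] makes the bound infinite, because the denominator is
   positive here. *)
case DE : (Delta f (x 1%N)) => [r| |] // r0; last first.
  by rewrite expe2 mulyy gt0_mulye ?leey// lte_fin invr_gt0.
rewrite expe2 -!EFinM lee_fin -expr2.
(* The last iterate may be a minimizer; the inverse of its gap is only
   meaningful otherwise. *)
have [->|e0] := eqVneq (f (x K.+1) - f xstar) 0.
  by rewrite mulr_ge0 ?sqr_ge0// invr_ge0 ltW.
have {}e0 : 0 < f (x K.+1) - f xstar by rewrite lt_def e0 gap_ge0.
have gapr k : (1 <= k <= K)%N -> f (x k) - f xstar <= enorm (grad f (x k)) * r.
  move=> kK; apply: le_trans (convex_gap_le hxstar (hsmooth.1 _) hconv (g0 k kK)) _.
  rewrite ler_pM2l ?g0// -lee_fin -DE; apply: ereal_sup_ubound.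
  exists (x k) => //=; apply: (HDM_nonincreasing hHDM).
  by case/andP: kK => -> /=; exact: leqW.
have {}r0 : 0 < r.
  have K1 : (1 <= 1 <= K)%N by [].
  by rewrite -(pmulr_rgt0 _ (g0 _ K1)) (lt_le_trans (gap_gt0 _ K1))// gapr.
have rate : \sum_(1 <= k < K.+1) progress f x P k / r ^+ 2
    <= (f (x K.+1) - f xstar)^-1.
  apply: (@sublinear_rate _ (fun k => f (x k) - f xstar)) => [k|k _|k kK].
  - case/andP=> k1; rewrite leq_eqVlt => /predU1P[->//|kK].
    by apply: gap_gt0; rewrite k1.
  - by rewrite divr_ge0 ?progress_ge0 ?sqr_ge0.
  have := HDM_descent hHDM kK (g0 k kK).
  suff : progress f x P k / r ^+ 2 * (f (x k) - f xstar) ^+ 2 <=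
    progress f x P k * enorm (grad f (x k)) ^+ 2 by lra.
  rewrite -mulrA ler_wpM2l ?progress_ge0// mulrC ler_pdivrMr ?exprn_gt0//.
  rewrite -exprMn ler_pXn2r ?nnegrE ?mulr_ge0 ?(ltW r0) ?(ltW (g0 k kK))//.
  exact: gapr.
rewrite ler_pdivlMr// mulrC -ler_pdivlMr//.
rewrite -ler_pdivrMl ?exprn_gt0// mulrC.
apply: le_trans rate; rewrite -mulr_suml ler_wpM2r// invr_ge0 sqr_ge0//.
Qed.
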